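(* Let $d\ge 1$ be an integer and let $\rho : \mathbb{R}^d \to [0,\infty)$ be a measurable function such that (a) $\rho$ is positive on a set of nonzero (Lebesgue) measure; (b) $\tilde\rho \in L^1(\mathbb{R}^d)$, where $\tilde\rho(x) = \sup\{\rho(y) : |y-x| \le 1\}$. Then, for $1 \le p < \infty$, the quantity $$\|f\|_{p,\rho} \,=\, \sup_{x \in \mathbb{R}^d} \left(\int_{\mathbb{R}^d} \rho(x-y)|f(y)|^p\,dy\right)^{1/p}$$ is equivalent to the norm $\|\cdot\|_{L^p_{\mathrm{ul}}}$ on $L^p_{\mathrm{ul}}(\mathbb{R}^d)$; that is, there exist constants $0<c\le C<\infty$ such that $c\,\|f\|_{L^p_{\mathrm{ul}}}\le \|f\|_{p,\rho}\le C\,\|f\|_{L^p_{\mathrm{ul}}}$ for all $f\in L^p_{\mathrm{ul}}(\mathbb{R}^d)$.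
   Context: For $1\le p<\infty$ and $f\in L^p_{\mathrm{loc}}(\mathbb{R}^d)$, $\|f\|_{L^p_{\mathrm{ul}}}=\sup_{x\in\mathbb{R}^d}\bigl(\int_{|y-x|\le1}|f(y)|^p\,dy\bigr)^{1/p}$. $\mathcal{L}^p_{\mathrm{ul}}(\mathbb{R}^d)$ is the space of $f\in L^p_{\mathrm{loc}}(\mathbb{R}^d)$ with $\|f\|_{L^p_{\mathrm{ul}}}<\infty$, and the uniformly local Lebesgue space is $L^p_{\mathrm{ul}}(\mathbb{R}^d)=\{f\in\mathcal{L}^p_{\mathrm{ul}}(\mathbb{R}^d) : \|\tau_yf-f\|_{L^p_{\mathrm{ul}}}\to0 \text{ as } y\to0\}$, where $(\tau_yf)(x)=f(x-y)$. *)

(* Defs.v *)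
From HB Require Import structures.
From mathcomp Require Import all_boot all_order all_algebra.
From mathcomp Require Import all_classical all_reals all_analysis.
Import numFieldNormedType.Exports.

Set Implicit Arguments.
Unset Strict Implicit.
Unset Printing Implicit Defensive.

Import Order.TTheory GRing.Theory Num.Theory.
Local Open Scope classical_set_scope.
Local Open Scope ring_scope.

(* Copy of 'rV[R]_d carrying the product of the Borel sigma-algebras of the
   coordinates. *)
Definition borel_rV (R : realType) (d : nat) : Type := 'rV[R]_d.

Section borel_measurable.
Context (R : realType).

Definition coord_rV (d : nat) (i : 'I_d) (x : 'rV[R]_d) : measurableTypeR R :=
  x 0 i.

HB.instance Definition _ (d : nat) := Pointed.on (borel_rV R d).

HB.instance Definition _ (d : nat) := @isMeasurable.Build
  default_measure_display (borel_rV R d) (g_sigma_preimage (@coord_rV d))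
  (@sigma_algebra0 _ _ _) (@sigma_algebraC _ _) (@sigma_algebra_bigcup _ _ _).

Definition cons_rV (d : nat) (z : measurableTypeR R * borel_rV R d) :
    borel_rV R d.+1 :=
  \row_i (if unlift ord0 i is Some j then (z.2 : 'rV[R]_d) 0 j else z.1).

Definition behead_rV (d : nat) (x : borel_rV R d.+1) : borel_rV R d :=
  \row_j (x : 'rV[R]_d.+1) 0 (lift ord0 j).

Lemma cons_rVK (d : nat) (z : measurableTypeR R * borel_rV R d) :
  (coord_rV ord0 (cons_rV z), behead_rV (cons_rV z)) = z.
Proof.
case: z => a v; congr pair; first by rewrite /coord_rV mxE unlift_none.
by apply/rowP => j; rewrite !mxE liftK.
Qed.

Lemma measurable_coord_rV (d : nat) (i : 'I_d) :
  measurable_fun [set: borel_rV R d] (coord_rV i).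
Proof.
move=> _ Y mY; rewrite setTI; apply: sub_sigma_algebra => /=.
rewrite -bigcup_seq/=; exists i => /=; first by rewrite mem_index_enum.
by exists Y => //; rewrite setTI.
Qed.

Lemma measurable_fun_rVP (disp : measure_display) (T : measurableType disp)
    (d : nat) (f : T -> borel_rV R d) :
  (forall i, measurable_fun [set: T] (coord_rV i \o f)) ->
  measurable_fun [set: T] f.
Proof.
move=> mf.
suff sub : g_sigma_preimage (fun i => coord_rV i \o f) `<=` measurable.
  move=> _ A mA; apply: sub; rewrite g_sigma_preimage_comp.
  by exists A.
apply: smallest_sub; first exact: sigma_algebra_measurable.
rewrite -bigcup_seq; apply: bigcup_sub => i _.
by move=> A [B mB <-]; exact: mf.
Qed.

Lemma measurable_cons_rV (d : nat) : measurable_fun setT (@cons_rV d).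
Proof.
apply: measurable_fun_rVP => i; case: (unliftP ord0 i) => [j ->|->].
  rewrite (_ : _ \o _ = coord_rV j \o snd); last first.
    by apply/funext => z; rewrite /coord_rV/= mxE liftK.
  exact: (measurableT_comp (@measurable_coord_rV d j) measurable_snd).
rewrite (_ : _ \o _ = fst)//.
by apply/funext => z; rewrite /coord_rV/= mxE unlift_none.
Qed.

Lemma measurable_behead_rV (d : nat) : measurable_fun setT (@behead_rV d).
Proof.
apply: measurable_fun_rVP => i.
rewrite (_ : _ \o _ = coord_rV (lift ord0 i)); last first.
  by apply/funext => z; rewrite /coord_rV/= mxE.
exact: measurable_coord_rV.
Qed.

Definition cons_measure (d : nat)
    (m : {sigma_finite_measure set (borel_rV R d) -> \bar R}) :
    set (borel_rV R d.+1) -> \bar R :=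
  pushforward (@lebesgue_measure R \x m)%E (@cons_rV d).

Section cons_measure_sigma_finite.
Variables (d : nat) (m : {sigma_finite_measure set (borel_rV R d) -> \bar R}).

Let cons_measure0 : cons_measure m set0 = 0%E.
Proof. by rewrite /cons_measure /pushforward preimage_set0 measure0. Qed.

Let cons_measure_ge0 A : (0 <= cons_measure m A)%E.
Proof. by rewrite /cons_measure /pushforward; exact: measure_ge0. Qed.

Let cons_measure_sigma_additive : semi_sigma_additive (cons_measure m).
Proof.
have mc A : measurable A -> measurable (@cons_rV d @^-1` A).
  by move=> mA; rewrite -[X in measurable X]setTI; exact: measurable_cons_rV.
move=> F mF tF mUF; rewrite /cons_measure /pushforward preimage_bigcup.
apply: measure_semi_sigma_additive.
- by move=> n; exact: mc.
- apply/trivIsetP => /= i j _ _ ij; rewrite -preimage_setI.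
  by move/trivIsetP : tF => /(_ _ _ _ _ ij) ->//; rewrite preimage_set0.
- by rewrite -preimage_bigcup; exact: mc.
Qed.

HB.instance Definition _ := isMeasure.Build _ _ _ (cons_measure m)
  cons_measure0 cons_measure_ge0 cons_measure_sigma_additive.

Let cons_measure_sigma_finite : sigma_finite setT (cons_measure m).
Proof.
have /sigma_finiteP[F [TF ndF Foo]] := sigma_finiteT (@lebesgue_measure R).
have /sigma_finiteP[G [TG ndG Goo]] := sigma_finiteT m.
exists (fun n => coord_rV ord0 @^-1` F n `&` @behead_rV d @^-1` G n).
  apply/esym; rewrite -subTset => x _.
  have [i _ Fi] : (\bigcup_i F i) (coord_rV ord0 x) by rewrite -TF.
  have [j _ Gj] : (\bigcup_i G i) (behead_rV x) by rewrite -TG.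
  exists (maxn i j) => //; split.
    by have /subsetPset/(_ _ Fi) := ndF _ _ (leq_maxl i j).
  by have /subsetPset/(_ _ Gj) := ndG _ _ (leq_maxr i j).
move=> n; have [mF Fn] := Foo n; have [mG Gn] := Goo n; split.
  apply: measurableI.
    by rewrite -[X in measurable X]setTI; exact: measurable_coord_rV.
  by rewrite -[X in measurable X]setTI; exact: measurable_behead_rV.
rewrite /cons_measure /pushforward (_ : _ @^-1` _ = F n `*` G n).
  by rewrite product_measure1E// lte_mul_pinfty// ge0_fin_numE.
apply/seteqP; split=> z /=; have := cons_rVK z.
  by case: z => a v [/= -> ->].
by case: z => a v [/= -> ->].
Qed.

HB.instance Definition _ := @Measure_isSigmaFinite.Build _ _ _ (cons_measure m)
  cons_measure_sigma_finite.

End cons_measure_sigma_finite.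

(* d-fold product of the one-dimensional Lebesgue measure. *)
Fixpoint lebesgue_borel_rV (d : nat) :
    {sigma_finite_measure set (borel_rV R d) -> \bar R} :=
  match d with
  | 0 => \d_((0 : 'rV[R]_0) : borel_rV R 0)
  | d'.+1 => cons_measure (lebesgue_borel_rV d')
  end.

End borel_measurable.

(* Copy of 'rV[R]_d carrying the Lebesgue sigma-algebra: the sets that are
   Caratheodory-measurable for the outer measure induced by
   lebesgue_borel_rV, i.e. the completion of the Borel sigma-algebra. The
   completion matters for unit_sup below: the unions of closed unit balls that
   are its superlevel sets are always Lebesgue-measurable. *)
Definition lebesgue_rV (R : realType) (d : nat) : Type :=
  caratheodory_type (lebesgue_borel_rV R d)^*%mu.

HB.instance Definition _ (R : realType) (d : nat) :=
  Measurable.on (lebesgue_rV R d).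

Definition lebesgue_measure_rV (R : realType) (d : nat) :
    {measure set (lebesgue_rV R d) -> \bar R} :=
  @completed_measure_extension _ _ _ (lebesgue_borel_rV R d).

Section uniformly_local.
Context (R : realType) (d : nat).
Local Notation E := 'rV[R]_d.
Local Notation mu := (lebesgue_measure_rV R d).
Implicit Types (p : R) (f rho : E -> R) (x y : E).

(* The library norm on 'rV[R]_d is the sup norm. *)
Definition euclidean_norm x : R := Num.sqrt (\sum_(i < d) x 0 i ^+ 2).

Definition unit_cball x : set E := [set y | euclidean_norm (y - x) <= 1].

Definition lebesgue_measurable f : Prop :=
  measurable_fun [set: lebesgue_rV R d] (f : lebesgue_rV R d -> R).

(* Predicates on functions rather than on classes modulo a.e. equality. *)
Definition Lploc p f : Prop :=
  lebesgue_measurable f /\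
  forall K : set E, compact K -> (\int[mu]_(y in K) (`|f y| `^ p)%:E < +oo)%E.

Definition Lul_norm p f : \bar R :=
  ereal_sup (range (fun x =>
    (\int[mu]_(y in unit_cball x) (`|f y| `^ p)%:E) `^ p^-1))%E.

Definition translation y f : E -> R := fun x => f (x - y).

Definition bounded_Lul p f : Prop := Lploc p f /\ (Lul_norm p f < +oo)%E.

Definition Lul p f : Prop :=
  bounded_Lul p f /\
  Lul_norm p (translation y f \- f) @[y --> (0 : E)] --> 0%E.

(* Values in \bar R, as the supremum may be infinite. *)
Definition unit_sup rho x : \bar R :=
  ereal_sup [set (rho y)%:E | y in unit_cball x].

Definition weighted_norm rho p f : \bar R :=
  ereal_sup (range (fun x =>
    (\int[mu]_y (rho (x - y) * `|f y| `^ p)%:E) `^ p^-1))%E.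

End uniformly_local.

(* Main.v *)
Require Import Defs.
From HB Require Import structures.
From mathcomp Require Import all_boot all_order all_algebra.
From mathcomp Require Import all_classical all_reals all_analysis.
From mathcomp Require Import measurable_realfun ring lra.
Import numFieldNormedType.Exports.

(** Both inequalities come from one averaging identity. For a set [E] of pairs
    whose slices [{z | E (z, y)}] all have the same measure [v], and nonnegative
    functions [g], [h], Tonelli's theorem computes the integral of
    [1_E (z, y) h z g y] in two orders. If [r y <= h z] on [E], integrating in
    [z] first gives at least [v * \int r g]; if [\int 1_E (z, y) g y dy <= M]
    for every [z], integrating in [y] first gives at most [M * \int h]. Hence
    [v * \int r g <= M * \int h], which is [indic_schur_integral_le], used with
    [g] a multiple of [|f|^p].

    Upper bound ([weighted_integral_le]). Let [Q] be a centred cube inside the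
    unit ball and [E = {z - y \in Q}]. Then [rho (x - y)] is at most
    [unit_sup rho (x - z)] on [E], and the [y]-integrals are bounded by local
    integrals of [|f|^p]. So [|Q| * \int rho (x - y) |f y|^p dy] is at most
    [||unit_sup rho||_1] times the p-th power of the uniformly local norm.

    Lower bound ([local_integral_le]). Since [rho] is positive on a non-null set,
    [rho > e] on some bounded Borel set [B] of positive measure
    ([exists_borel_lower_bound]). Take [E = {w - y \in B}]. For [y] in the unit
    ball around [x], [E (w, y)] confines [w] to a fixed cube [D] around [x], and
    the [y]-integrals of [e 1_B (w - y) |f y|^p] are at most the p-th power of the
    weighted norm. So [e * |B|] times the integral of [|f|^p] over that ball is at
    most [|D|] times that p-th power.

    The measures of the slices, and the integral of [z |-> unit_sup rho (x - z)],
    are computed from the invariance of Lebesgue measure under the point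
    reflections [y |-> x - y], which passes from the line
    to products by uniqueness of product measures, then to the outer measure, hence
    to the completed sigma-algebra. Working with a Borel set [B], instead of [rho]
    itself, is what makes [E] measurable: for a function [rho] that is only
    Lebesgue-measurable, [(w, y) |-> rho (w - y)] can fail to be measurable for
    the product of the two Lebesgue sigma-algebras. *)

Set Implicit Arguments.
Unset Strict Implicit.
Unset Printing Implicit Defensive.

Import Order.TTheory GRing.Theory Num.Theory.
Local Open Scope classical_set_scope.
Local Open Scope ring_scope.

(** * Reflections and cubes for the Borel product measure *)

Section borel.
Context (R : realType).

Lemma measurable_subl (a : R) :
  measurable_fun [set: measurableTypeR R]
    ((fun t : R => a - t) : measurableTypeR R -> measurableTypeR R).
Proof. by apply: (@measurable_funB _ R R setT (cst a) id). Qed.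

(** It suffices to compare the two measures on half-open intervals, where the
    reflection only exchanges the open and the closed end. *)
Lemma lebesgue_measure_subl (a : R) (A : set (measurableTypeR R)) : measurable A ->
  @lebesgue_measure R ((fun t => a - t) @^-1` A) = lebesgue_measure A.
Proof.
move=> mA; pose phi : measurableTypeR R -> measurableTypeR R := fun t => a - t.
have mphi : measurable_fun setT phi by exact: measurable_subl.
pose phi' : {mfun measurableTypeR R >-> measurableTypeR R} :=
  HB.pack phi (isMeasurableFun.Build _ _ _ _ _ mphi).
suff /(_ _ mA) -> : forall A, measurable A ->
    lebesgue_measure A = pushforward (@lebesgue_measure R) phi' A by [].
apply: lebesgue_measure_unique => X [[c d] _ <-] /=.
rewrite /pushforward /= (_ : phi @^-1` _ = `[a - d, a - c[%classic); last first.
  apply/seteqP; split => x; rewrite /phi /= !in_itv/= => /andP[? ?].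
    by apply/andP; split; lra.
  by apply/andP; split; lra.
rewrite !lebesgue_measure_itv /= !lte_fin.
have -> : (a - d < a - c) = (c < d) by apply/idP/idP; lra.
by case: ifP => // _; rewrite -!EFinB; congr EFin; ring.
Qed.

(** Reflections are preferred to translations because the kernel [rho (x - y)] is
    itself a reflection in [y], and because they are involutive: an inequality
    of measures valid for all sets is automatically an equality. *)
Definition point_refl (d : nat) (x : 'rV[R]_d) : borel_rV R d -> borel_rV R d :=
  fun y => x - y.

Lemma measurable_refl d x : measurable_fun setT (@point_refl d x).
Proof.
apply: measurable_fun_rVP => i.
rewrite (_ : _ \o _ =
  (fun t : measurableTypeR R => x 0 i - t : measurableTypeR R) \o coord_rV i);
    last first.
  by apply/funext => y; rewrite /coord_rV/= !mxE.
exact: (measurableT_comp (measurable_subl _) (measurable_coord_rV i)).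
Qed.

(** The reflection acts separately on the first coordinate and on the others, so
    induction on [d] and uniqueness of the product measure apply. *)
Lemma lebesgue_borel_refl d x (A : set (borel_rV R d)) : measurable A ->
  lebesgue_borel_rV R d (point_refl x @^-1` A) = lebesgue_borel_rV R d A.
Proof.
elim: d x A => [|d IHd] x A mA.
  congr (lebesgue_borel_rV R 0 _).
  by apply/seteqP; split => y /=; rewrite /point_refl (_ : x - y = y)//;
    apply/rowP => -[].
rewrite /= /cons_measure /pushforward.
pose x' : 'rV[R]_d := \row_j x 0 (lift ord0 j).
pose psi (z : measurableTypeR R * borel_rV R d) :
    measurableTypeR R * borel_rV R d := (x 0 ord0 - z.1 : R, point_refl x' z.2).
have mpsi : measurable_fun setT psi.
  apply/measurable_fun_pairP; split.
    exact: (measurableT_comp (measurable_subl _) measurable_fst).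
  exact: (measurableT_comp (measurable_refl _) measurable_snd).
pose psi' : {mfun _ >-> _} := HB.pack psi (isMeasurableFun.Build _ _ _ _ _ mpsi).
have mcA : measurable (@cons_rV R d @^-1` A).
  by rewrite -[X in measurable X]setTI; exact: measurable_cons_rV.
have reflE : point_refl x \o @cons_rV R d = @cons_rV R d \o psi.
  apply/funext => -[a v]; apply/rowP => i; rewrite /point_refl/= !mxE.
  by case: (unliftP ord0 i) => [j ->|->]; rewrite ?liftK ?unlift_none ?mxE.
have -> : @cons_rV R d @^-1` (point_refl x @^-1` A) =
    psi @^-1` (@cons_rV R d @^-1` A).
  exact: (congr1 (fun h => h @^-1` A) reflE).
apply/esym.
apply: (@product_measure_unique _ _ _ _ R lebesgue_measure (lebesgue_borel_rV R d)
  (pushforward (lebesgue_measure \x lebesgue_borel_rV R d)%E psi')) => //.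
move=> B C mB mC /=.
rewrite /pushforward /= (_ : psi @^-1` _ =
  ((fun t => x 0 ord0 - t) @^-1` B) `*` (point_refl x' @^-1` C))//.
rewrite product_measure1E.
- by congr (_ * _)%E; [exact: lebesgue_measure_subl|exact: IHd].
- by rewrite -[X in measurable X]setTI; exact: measurable_subl.
- by rewrite -[X in measurable X]setTI; exact: measurable_refl.
Qed.

(** Cubes replace Euclidean balls wherever a volume is needed: theirs is an
    immediate induction on the dimension. *)
Definition cube d (r : R) : set (borel_rV R d) :=
  [set y | forall i, `|y 0 i| <= r].

Lemma measurable_cube d r : measurable (@cube d r).
Proof.
rewrite (_ : cube r = \bigcap_(i in [set: 'I_d]) (coord_rV i @^-1` `[- r, r])).
  apply: fin_bigcap_measurable => [|i _]; first exact: finite_finset.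
  by rewrite -[X in measurable X]setTI; apply: measurable_coord_rV.
by apply/seteqP; split => y /= h i; [move=> _ | have := h i I];
  rewrite /coord_rV/= in_itv/= -ler_norml.
Qed.

Lemma lebesgue_borel_cube d (r : R) : 0 <= r ->
  lebesgue_borel_rV R d (cube r) = ((2 * r) ^+ d)%:E.
Proof.
move=> r0; elim: d => [|d IHd].
  by rewrite expr0 /= diracE mem_set//= => -[].
rewrite /= /cons_measure /pushforward.
rewrite (_ : _ @^-1` _ = `[-r, r] `*` cube r).
  rewrite product_measure1E//; last exact: measurable_cube.
  rewrite [X in (X * _)%E]lebesgue_measure_itv /= lte_fin IHd exprS EFinM.
  case: ifPn => [_|nr]; first by rewrite -EFinB; congr (_%:E * _)%E; ring.
  by rewrite (_ : r = 0) ?mulr0//; lra.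
apply/seteqP; split => -[a v]/=.
  move=> h; split.
    by have := h ord0; rewrite mxE unlift_none in_itv/= -ler_norml.
  by move=> i; have := h (lift ord0 i); rewrite mxE liftK.
move=> [ha hv] i; rewrite mxE; case: (unliftP ord0 i) => [j _|_]; first exact: hv.
by move: ha; rewrite in_itv/= -ler_norml.
Qed.

End borel.

(** * A Schur-type integral inequality *)

(** Tonelli's theorem for [h x * g y * k (x, y)]: the inner integral is bounded
    above in one order and below in the other. *)
Lemma schur_integral_le d1 d2 (T1 : measurableType d1) (T2 : measurableType d2)
    (R : realType) (m1 : {sigma_finite_measure set T1 -> \bar R})
    (m2 : {sigma_finite_measure set T2 -> \bar R})
    (k : T1 * T2 -> \bar R) (h : T1 -> \bar R) (g a : T2 -> \bar R) (M : \bar R) :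
  measurable_fun setT k -> measurable_fun setT h ->
  measurable_fun setT g -> measurable_fun setT a ->
  (forall z, 0 <= k z)%E -> (forall x, 0 <= h x)%E ->
  (forall y, 0 <= g y)%E -> (forall y, 0 <= a y)%E -> (0 <= M)%E ->
  (forall x, \int[m2]_y (k (x, y) * g y) <= M)%E ->
  (forall y, a y <= \int[m1]_x (k (x, y) * h x))%E ->
  (\int[m2]_y (g y * a y) <= \int[m1]_x h x * M)%E.
Proof.
move=> mk mh mg ma k0 h0 g0 a0 M0 gM ah.
pose hgk z := (h z.1 * g z.2 * k z)%E.
have hgk0 z : (0 <= hgk z)%E by rewrite !mule_ge0.
have mhgk : measurable_fun setT hgk.
  apply: emeasurable_funM => //; apply: emeasurable_funM.
    exact: (measurableT_comp mh measurable_fst).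
  exact: (measurableT_comp mg measurable_snd).
apply: (@le_trans _ _ (\int[m2]_y \int[m1]_x hgk (x, y))%E).
  apply: ge0_le_integral => //.
  - by move=> y _; rewrite mule_ge0.
  - exact: emeasurable_funM.
  - exact: (measurable_fun_fubini_tonelli_G hgk).
  move=> y _; have mky : measurable_fun setT (fun x => k (x, y) * h x)%E.
    apply: emeasurable_funM => //.
    exact: (measurableT_comp mk (measurable_pair2 y)).
  rewrite (eq_integral (fun x => g y * (k (x, y) * h x))%E); last first.
    by move=> x _; rewrite /hgk/= muleC (muleC (h x)) muleCA.
  rewrite ge0_integralZl//; first exact: lee_wpmul2l.
  by move=> x _; rewrite mule_ge0.
rewrite -fubini_tonelli// -ge0_integralZr//.
apply: ge0_le_integral => //.
- by move=> x _; exact: integral_ge0.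
- exact: (measurable_fun_fubini_tonelli_F hgk).
- exact: emeasurable_funM.
move=> x _; have mkx : measurable_fun setT (fun y => k (x, y) * g y)%E.
  apply: emeasurable_funM => //.
  exact: (measurableT_comp mk (measurable_pair1 x)).
rewrite (eq_integral (fun y => h x * (k (x, y) * g y))%E); last first.
  by move=> y _; rewrite /hgk/= (muleC (k _)) muleA.
rewrite ge0_integralZl//; first exact: lee_wpmul2l.
by move=> y _; rewrite mule_ge0.
Qed.

(** The form used for both bounds, with [k] the indicator of [E]. The function
    [s] is a measurable majorant of [g] on the slices of [E] whose integral is
    known to be at most [M]: the restriction of [g] to a ball for the upper bound
    of the theorem, the weighted integrand for the lower one. *)
Lemma indic_schur_integral_le d1 d2 (T1 : measurableType d1) (T2 : measurableType d2)
    (R : realType) (m1 : {sigma_finite_measure set T1 -> \bar R})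
    (m2 : {sigma_finite_measure set T2 -> \bar R}) (E : set (T1 * T2))
    (h : T1 -> \bar R) (g r : T2 -> \bar R) (s : T1 -> T2 -> \bar R) (v M : \bar R) :
  measurable E -> measurable_fun setT h ->
  measurable_fun setT g -> measurable_fun setT r ->
  (forall x, measurable_fun setT (s x)) ->
  (forall x, 0 <= h x)%E ->
  (forall y, 0 <= g y)%E -> (forall y, 0 <= r y)%E ->
  (forall x y, 0 <= s x y)%E -> (0 <= v)%E -> (0 <= M)%E ->
  (forall x y, E (x, y) -> g y <= s x y)%E ->
  (forall x, \int[m2]_y s x y <= M)%E ->
  (forall x y, E (x, y) -> r y <= h x)%E ->
  (forall y, \int[m1]_x (\1_E (x, y))%:E = v)%E ->
  (v * \int[m2]_y (r y * g y) <= \int[m1]_x h x * M)%E.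
Proof.
move=> mE mh mg mr ms h0 g0 r0 s0 v0 M0 gs sM rh Ev.
pose k z : \bar R := (\1_E z)%:E.
have mk : measurable_fun setT k by exact/measurable_EFinP/measurable_indic.
have k0 z : (0 <= k z)%E by rewrite lee_fin.
have mk1 x : measurable_fun setT (fun y => k (x, y)).
  exact: (measurableT_comp mk (measurable_pair1 x)).
have mk2 y : measurable_fun setT (fun x => k (x, y)).
  exact: (measurableT_comp mk (measurable_pair2 y)).
rewrite -ge0_integralZl//; last 2 first.
- exact: emeasurable_funM.
- by move=> y _; rewrite mule_ge0.
rewrite (eq_integral (fun y => g y * (r y * v))%E); last first.
  by move=> y _; rewrite muleC (muleC (r y)) muleA.
apply: (@schur_integral_le _ _ _ _ _ m1 m2 k) => //.
- by apply: emeasurable_funM.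
- by move=> y; rewrite mule_ge0.
- move=> x; apply: le_trans (sM x); apply: ge0_le_integral => //.
  + by move=> y _; rewrite mule_ge0.
  + exact: emeasurable_funM.
  move=> y _; rewrite /k indicE.
  case: (boolP (_ \in E)) => [|_]; last by rewrite mul0e.
  by rewrite inE mul1e; exact: gs.
- have Ek y : (\int[m1]_x k (x, y) = v)%E by exact: Ev.
  move=> y; rewrite -(Ek y) -ge0_integralZl//.
  apply: ge0_le_integral => //.
  + by move=> x _; rewrite mule_ge0.
  + exact: emeasurable_funM.
  + exact: emeasurable_funM.
  move=> x _; rewrite muleC /k indicE.
  case: (boolP (_ \in E)) => [|_]; last by rewrite !mul0e.
  by rewrite inE !mul1e; exact: rh.
Qed.

Lemma ge0_integral_scale_indic d0 (T : measurableType d0) (R : realType)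
    (m : {measure set T -> \bar R}) (A : set T) (g : T -> \bar R) (e : R) :
  measurable A -> measurable_fun setT g -> (forall y, 0 <= g y)%E -> 0 <= e ->
  (e%:E * \int[m]_(y in A) g y = \int[m]_y ((\1_A y)%:E * (e%:E * g y)))%E.
Proof.
move=> mA mg g0 e0; rewrite integral_mkcond -ge0_integralZl_EFin//; last 2 first.
- by move=> y _; exact: erestrict_ge0.
- by apply/(measurable_restrictT _ mA); exact: measurable_funTS.
apply: eq_integral => y _; rewrite patchE indicE.
by case: ifP => _; rewrite ?mul1e// mul0e mule0.
Qed.

(** * Reflections for the completed Lebesgue measure *)

Section lebesgue.
Context (R : realType) (d : nat).
Local Notation borel := (borel_rV R d).
Local Notation leb := (lebesgue_rV R d).
Local Notation mu := (lebesgue_measure_rV R d).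

Lemma lebesgue_measurable_borel (A : set borel) :
  measurable A -> measurable (A : set leb).
Proof. exact: caratheodory_measurable_mu_ext. Qed.

Lemma lebesgue_measure_borel (A : set borel) :
  measurable A -> mu A = lebesgue_borel_rV R d A.
Proof. exact: measurable_mu_extE. Qed.

Lemma measurable_lebesgue_borel : measurable_fun [set: leb] (id : leb -> borel).
Proof. by move=> _ A mA; rewrite setTI; exact: lebesgue_measurable_borel. Qed.

Lemma lebesgue_sigma_finite : sigma_finite [set: leb] mu.
Proof. exact/completed_measure_extension_sigma_finite/sigma_finiteT. Qed.

HB.instance Definition _ := @Measure_isSigmaFinite.Build _ _ _
  (@completed_measure_extension _ _ _ (lebesgue_borel_rV R d))
  lebesgue_sigma_finite.

(** The same function as [lebesgue_measure_rV], packaged with its sigma-finiteness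
    as Tonelli's theorem requires. *)
Definition lebesgue_sf_measure_rV : {sigma_finite_measure set leb -> \bar R} :=
  @completed_measure_extension _ _ _ (lebesgue_borel_rV R d).

Lemma reflK (x : 'rV[R]_d) : involutive (point_refl x).
Proof. by move=> y; rewrite /point_refl opprB addrCA subrr addr0. Qed.

(** Reflecting a Borel cover of [A] gives a Borel cover of its reflection with the
    same total measure; the reverse inequality follows because the reflection is
    involutive. *)
Lemma lebesgue_outer_refl (x : 'rV[R]_d) (A : set borel) :
  ((lebesgue_borel_rV R d)^* (point_refl x @^-1` A))%mu =
  ((lebesgue_borel_rV R d)^* A)%mu.
Proof.
have le B : (((lebesgue_borel_rV R d)^*)%mu (point_refl x @^-1` B) <=
             ((lebesgue_borel_rV R d)^*)%mu B)%E.
  apply: le_ereal_inf_tmp => _ [F [mF BF] <-].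
  have mrefl C : measurable C -> measurable (point_refl x @^-1` C).
    by move=> mC; rewrite -[X in measurable X]setTI; exact: measurable_refl.
  apply: ereal_inf_lbound; exists (fun n => point_refl x @^-1` F n).
    split=> [n|y /= /BF [n _ Fn]]; first exact: mrefl.
    by exists n.
  by apply: eq_eseriesr => n _; exact: lebesgue_borel_refl.
apply/eqP; rewrite eq_le le/= (le_trans _ (le _))// le_mu_ext//.
by move=> y Ay /=; rewrite reflK.
Qed.

(** Caratheodory's criterion only involves the outer measure, which is invariant:
    testing the reflection of [A] against [X] amounts to testing [A] against the
    reflection of [X]. *)
Lemma lebesgue_measurable_refl (x : 'rV[R]_d) :
  measurable_fun [set: leb] (point_refl x : leb -> leb).
Proof.
move=> _ A mA; rewrite setTI.
have cA : ((lebesgue_borel_rV R d)^*)%mu.-caratheodory A := mA.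
suff : ((lebesgue_borel_rV R d)^*)%mu.-caratheodory
  (point_refl x @^-1` A) by [].
have reflI (B X : set borel) : X `&` point_refl x @^-1` B =
    point_refl x @^-1` (point_refl x @^-1` X `&` B).
  by apply/seteqP; split => y /=; rewrite reflK.
move=> X; rewrite (reflI A) (reflI (~` A)) !lebesgue_outer_refl -cA.
exact/esym/lebesgue_outer_refl.
Qed.

Lemma ge0_integral_refl (x : 'rV[R]_d) (g : leb -> \bar R) :
  measurable_fun setT g -> (forall y, 0 <= g y)%E ->
  (\int[mu]_y g (point_refl x y) = \int[mu]_y g y)%E.
Proof.
move=> mg g0; pose phi : {mfun leb >-> leb} :=
  HB.pack (point_refl x : leb -> leb)
    (isMeasurableFun.Build _ _ _ _ _ (lebesgue_measurable_refl x)).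
rewrite [RHS](eq_measure_integral (pushforward mu phi)); last first.
  move=> A mA _; rewrite /pushforward/=; apply/esym.
  exact: lebesgue_outer_refl.
by rewrite ge0_integral_pushforward//; exact: lebesgue_measurable_refl.
Qed.

(** A translation is the composite of two point reflections. *)
Lemma ge0_integral_subr (x : 'rV[R]_d) (g : leb -> \bar R) :
  measurable_fun setT g -> (forall y, 0 <= g y)%E ->
  (\int[mu]_y g ((y : 'rV[R]_d) - x)%R = \int[mu]_y g y)%E.
Proof.
move=> mg g0.
transitivity (\int[mu]_y (g \o point_refl 0) (point_refl x y))%E.
  by apply: eq_integral => y _ /=; congr g; rewrite /point_refl sub0r opprB.
rewrite (@ge0_integral_refl x (g \o point_refl 0)) => [| |y]; last exact: g0.
- exact: (@ge0_integral_refl 0 g).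
- exact: (measurableT_comp mg (lebesgue_measurable_refl 0)).
Qed.

Lemma integral_indic_subr (x : 'rV[R]_d) (A : set leb) : measurable A ->
  (\int[mu]_y (\1_A ((y : 'rV[R]_d) - x))%:E = mu A)%E.
Proof.
move=> mA.
have m1 : measurable_fun setT (EFin \o \1_A : leb -> \bar R).
  exact/measurable_EFinP/measurable_indic.
have i0 y : (0 <= (EFin \o \1_A : leb -> \bar R) y)%E by rewrite lee_fin.
apply: etrans (ge0_integral_subr x m1 i0) _.
by apply: etrans (integral_indic mu measurableT mA) _; rewrite setIT.
Qed.

(** The product sigma-algebra on pairs is generated by Lebesgue-measurable
    rectangles, for which subtraction is only measurable towards the Borel sets:
    hence the requirement that [S] be Borel. *)
Lemma measurable_sub_preimage (S : set borel) : measurable S ->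
  measurable [set z : leb * leb | S ((z.1 : 'rV[R]_d) - z.2)].
Proof.
move=> mS; pose s (z : leb * leb) : borel := (z.1 : 'rV[R]_d) - z.2.
suff ms : measurable_fun setT s by rewrite -[X in measurable X]setTI; exact: ms.
apply: measurable_fun_rVP => i.
rewrite (_ : _ \o _ = (fun z => coord_rV i z.1 - coord_rV i z.2 : R)); last first.
  by apply/funext => z; rewrite /coord_rV /s/= !mxE.
have mi : measurable_fun [set: leb] (coord_rV i : leb -> R).
  exact: (measurableT_comp (measurable_coord_rV i) measurable_lebesgue_borel).
apply: (@measurable_funB _ _ R).
  exact: (measurableT_comp mi measurable_fst).
exact: (measurableT_comp mi measurable_snd).
Qed.

Lemma lebesgue_integral_indic_sub (S : set borel) (y : 'rV[R]_d) : measurable S ->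
  (\int[mu]_x
     (\1_[set z : leb * leb | S ((z.1 : 'rV[R]_d) - z.2)%R] (x, y))%:E = mu S)%E.
Proof.
move=> /lebesgue_measurable_borel mS; rewrite -(integral_indic_subr y mS).
by apply: eq_integral => x _; rewrite !indicE; congr (_%:R%:E).
Qed.

End lebesgue.

(** * Suprema of p-th roots *)

Section powers.
Context (R : realType) (p : R).
Hypothesis p0 : 0 < p.
Local Open Scope ereal_scope.

Lemma poweR_inv_le (x y : \bar R) : 0 <= x -> 0 <= y ->
  (x `^ p^-1 <= y) = (x <= y `^ p).
Proof.
move=> x0 y0; have xK (z : \bar R) : 0 <= z -> (z `^ p^-1) `^ p = z.
  by move=> z0; rewrite -poweRrM mulVf ?gt_eqF// poweRe1.
have xK' (z : \bar R) : 0 <= z -> (z `^ p) `^ p^-1 = z.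
  by move=> z0; rewrite -poweRrM mulfV ?gt_eqF// poweRe1.
have mono (r : R) (u v : \bar R) : (0 < r)%R -> 0 <= u -> 0 <= v ->
    u <= v -> u `^ r <= v `^ r.
  move=> r0 u0 v0; apply: gt0_ler_poweR; rewrite ?ltW//.
    by rewrite in_itv/= u0 leey.
  by rewrite in_itv/= v0 leey.
apply/idP/idP => h.
  by rewrite -[x]xK//; apply: mono => //; exact: poweR_ge0.
by rewrite -[y]xK'//; apply: mono => //; [rewrite invr_gt0|exact: poweR_ge0].
Qed.

Lemma ereal_sup_poweR_inv_le (T : Type) (I : T -> \bar R) (K : R) (M : \bar R) :
  (0 <= K)%R -> 0 <= M -> (forall x, 0 <= I x) ->
  (forall x, I x <= K%:E * M `^ p) ->
  ereal_sup (range (fun x => I x `^ p^-1)) <= (K `^ p^-1)%:E * M.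
Proof.
move=> K0 M0 I0 IM; apply: ge_ereal_sup => _ [x _ <-].
rewrite poweR_inv_le//; last by rewrite mule_ge0// lee_fin powR_ge0.
rewrite poweRM// ?lee_fin ?powR_ge0// poweR_EFin -powRrM mulVf ?gt_eqF//.
by rewrite powRr1.
Qed.

Lemma le_ereal_sup_poweR_inv (T : Type) (I : T -> \bar R) (x : T) :
  (forall x, 0 <= I x) ->
  I x <= (ereal_sup (range (fun x => I x `^ p^-1))) `^ p.
Proof.
move=> I0; have le : I x `^ p^-1 <= ereal_sup (range (fun x => I x `^ p^-1)).
  by apply: ereal_sup_ubound; exists x.
by rewrite -poweR_inv_le// (le_trans _ le)// poweR_ge0.
Qed.

Lemma ereal_sup_poweR_inv_ge0 (T : Type) (t : T) (I : T -> \bar R) :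
  0 <= ereal_sup (range (fun x => I x `^ p^-1)).
Proof.
apply: (@le_trans _ _ (I t `^ p^-1)); first exact: poweR_ge0.
by apply: ereal_sup_ubound; exists t.
Qed.
End powers.

(** * Unit balls, cubes and Borel subsets of non-null sets *)

Section geometry.
Context (R : realType) (d : nat).
Local Notation leb := (lebesgue_rV R d).
Local Notation mu := (lebesgue_measure_rV R d).

Lemma unit_cballE (x y : 'rV[R]_d) :
  unit_cball x y <-> \sum_(i < d) (x 0 i - y 0 i) ^+ 2 <= 1.
Proof.
rewrite /unit_cball/= /euclidean_norm -[X in Num.sqrt _ <= X]sqrtr1 ler_sqrt//.
rewrite (eq_bigr (fun i => (x 0 i - y 0 i) ^+ 2))// => i _.
by rewrite !mxE -sqrrN opprB.
Qed.

Lemma measurable_unit_cball (x : 'rV[R]_d) : measurable (unit_cball x : set leb).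
Proof.
pose q (y : leb) : R := \sum_(i < d) (x 0 i - coord_rV i (y : 'rV[R]_d)) ^+ 2.
have mq : measurable_fun [set: leb] q.
  apply: measurable_sum => i; apply: measurable_funX.
  apply: (measurableT_comp (measurable_subl (x 0 i))).
  exact: (measurableT_comp (measurable_coord_rV i) (@measurable_lebesgue_borel R d)).
rewrite (_ : unit_cball x = q @^-1` `]-oo, 1]).
  by rewrite -[X in measurable X]setTI; exact: mq.
by apply/seteqP; split => y; rewrite /preimage/= in_itv/=; move/unit_cballE.
Qed.

Lemma unit_cball_cube (x y : 'rV[R]_d) : unit_cball x y -> cube 1 (x - y).
Proof.
move=> /unit_cballE h i; rewrite !mxE.
rewrite -(@expr_le1 _ 2)// real_normK ?num_real// (le_trans _ h)//.
by rewrite (bigD1 i)//= lerDl; apply: sumr_ge0 => j _; exact: sqr_ge0.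
Qed.

Lemma cube_unit_cball (x y : 'rV[R]_d) : cube d%:R^-1 (x - y) -> unit_cball x y.
Proof.
move=> h; apply/unit_cballE.
apply: (@le_trans _ _ (\sum_(i < d) d%:R^-1)).
  apply: ler_sum => i _; have := h i; rewrite !mxE => hi.
  rewrite -real_normK ?num_real// expr2 (le_trans _ hi)// ler_piMl// (le_trans hi)//.
  by rewrite invf_le1 ?ler1n ?ltr0n (leq_ltn_trans _ (ltn_ord i)).
rewrite sumr_const card_ord -[_ *+ d]mulr_natr.
have [->|dn0] := eqVneq (d%:R : R) 0; first by rewrite mulr0.
by rewrite mulVf.
Qed.

(** By definition of the outer measure, [K `\` A] has a Borel cover [U] with
    [mu U < mu K], since [mu (K `\` A) < mu K]; then [K `\` U] is a Borel subset
    of [A] which cannot be null. *)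
Lemma lebesgue_inner_borel (K : set (borel_rV R d)) (A : set leb) :
  measurable K -> (mu K < +oo)%E -> measurable A -> A `<=` K -> mu A != 0%E ->
  exists B : set (borel_rV R d), [/\ measurable B, B `<=` A & mu B != 0%E].
Proof.
move=> mK Koo mA AK A0.
have mK' : measurable (K : set leb) by exact: lebesgue_measurable_borel.
have KAE : mu K = (mu (K `\` A) + mu A)%E.
  by rewrite (measureDI mu mK' mA); congr (_ + mu _)%E; rewrite setIC setIidl.
have KAfin : mu (K `\` A) \is a fin_num.
  rewrite ge0_fin_numE ?measure_ge0// (le_lt_trans _ Koo)// le_measure ?inE//.
  exact: measurableD.
have : (mu (K `\` A) < mu K)%E.
  by rewrite KAE lteDl// lt0e A0 measure_ge0.
move=> /ereal_inf_lt[_ [F [mF KAF] <-] FK].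
pose U := \bigcup_n F n.
have mU : measurable U by exact: bigcup_measurable.
have mB : measurable (K `\` U) by exact: measurableD.
exists (K `\` U); split => //.
  by move=> y [Ky nU]; apply: contrapT => nA; apply/nU/KAF.
apply/eqP => B0; have : (lebesgue_borel_rV R d K < lebesgue_borel_rV R d K)%E.
  rewrite (le_lt_trans _
    (_ : \sum_(0 <= i <oo) lebesgue_borel_rV R d (F i) < _)%E)//; last first.
    by rewrite -lebesgue_measure_borel.
  have -> : lebesgue_borel_rV R d K = lebesgue_borel_rV R d (K `&` U).
    have := measureDI (lebesgue_borel_rV R d) mK mU.
    by rewrite -[X in (X + _)%E](lebesgue_measure_borel mB) B0 add0e.
  apply: le_trans (generalized_Boole_inequality _ _ _) => //.
  by rewrite le_measure ?inE//; exact: measurableI.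
by rewrite ltxx.
Qed.

Lemma lebesgue_measure_cube (r : R) : 0 <= r ->
  mu (cube r) = ((2 * r) ^+ d)%:E.
Proof.
move=> r0; rewrite lebesgue_measure_borel; first exact: lebesgue_borel_cube.
exact: measurable_cube.
Qed.

(** [{rho > 0}] is the increasing union of the bounded sets
    [{rho > 1 / (n + 1)} `&` cube n], so one of these is not null. *)
Lemma exists_borel_lower_bound (rho : leb -> R) :
  measurable_fun setT rho -> mu [set x | 0 < rho x] != 0%E ->
  exists n (B : set (borel_rV R d)), [/\ measurable B, mu B != 0%E,
    B `<=` cube n%:R & B `<=` [set x | n.+1%:R^-1 < rho x]].
Proof.
move=> mrho rho0.
pose A n : set leb := rho @^-1` `]n.+1%:R^-1, +oo[ `&` cube n%:R.
have mA n : measurable (A n).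
  apply: measurableI.
    by rewrite -[X in measurable X]setTI; apply: mrho.
  by apply: lebesgue_measurable_borel; exact: measurable_cube.
have [n An0] : exists n, mu (A n) != 0%E.
  apply: contrapT => /forallNP A0.
  have : mu (\bigcup_n A n) = 0%E.
    apply/negligibleP; first exact: bigcup_measurable.
    apply: negligible_bigcup => n; apply/(negligibleP mu (mA n)).
    by have /negP/negPn/eqP := A0 n.
  suff -> : \bigcup_n A n = [set x | 0 < rho x].
    by move=> rho_eq0; rewrite rho_eq0 eqxx in rho0.
  apply/seteqP; split => [y [k _ [/=]]|y /= y0].
    by rewrite in_itv/= andbT => /(le_lt_trans _) h _; exact: h.
  pose b (t : R) := Num.bound `|t|.
  have [k kP] := ltr_add_invr y0; rewrite add0r in kP.
  pose n := maxn k (\max_(i < d) b ((y : 'rV[R]_d) 0%R i)).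
  exists n => //; split=> /=.
    rewrite in_itv/= andbT (le_lt_trans _ kP)// lef_pV2 ?posrE// ler_nat ltnS.
    exact: leq_maxl.
  move=> i; apply: (le_trans (ltW (archi_boundP (normr_ge0 _)))).
  by rewrite ler_nat (leq_trans _ (leq_maxr _ _))// (leq_bigmax i).
have [B [mB BA B0]] := @lebesgue_inner_borel (cube n%:R) (A n) (measurable_cube _)
  (eq_ind_r (fun v => v < +oo)%E (ltry _) (lebesgue_measure_cube (ler0n _ _)))
  (mA n) (@subIsetr _ _ _) An0.
exists n, B; split=> //.
  by move=> y /BA[].
by move=> y /BA[]; rewrite /= in_itv/= andbT.
Qed.

End geometry.

(** * The two integral estimates *)

Section bounds.
Context (R : realType) (d : nat).
Local Notation leb := (lebesgue_rV R d).
Local Notation mu := (lebesgue_measure_rV R d).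
Variables (rho : 'rV[R]_d -> R) (g : leb -> \bar R).
Hypotheses (rho_ge0 : forall x, 0 <= rho x)
  (rho_meas : measurable_fun [set: leb] (rho : leb -> R)).
Hypotheses (mg : measurable_fun [set: leb] g) (g0 : forall y, (0 <= g y)%E).

Lemma le_unit_sup (x y : 'rV[R]_d) :
  unit_cball x y -> ((rho y)%:E <= unit_sup rho x)%E.
Proof. by move=> xy; apply: ereal_sup_ubound; exists y. Qed.

Lemma unit_sup_ge0 (x : 'rV[R]_d) : (0 <= unit_sup rho x)%E.
Proof.
apply: (@le_trans _ _ (rho x)%:E); first by rewrite lee_fin.
apply: le_unit_sup; apply/unit_cballE.
by rewrite big1 ?ler01// => i _; rewrite subrr expr0n.
Qed.

(** Averaging [rho (x - y) <= unit_sup rho (x - z)] over [z] in the cube of centre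
    [y] and half side [1 / d], whose volume is [(2 / d) ^ d]; this cube lies in
    the unit ball because a sum of [d] squares of reals of absolute value at most
    [1 / d] is at most [1]. *)
Lemma weighted_integral_le (M : \bar R) (x : 'rV[R]_d) :
  measurable_fun [set: leb] (unit_sup rho : leb -> \bar R) -> (0 <= M)%E ->
  (forall z, \int[mu]_(y in unit_cball z) g y <= M)%E ->
  (((2 * d%:R^-1) ^+ d)%:E * \int[mu]_y ((rho (x - (y : 'rV[R]_d))%R)%:E * g y) <=
   (\int[mu]_y unit_sup rho y) * M)%E.
Proof.
move=> msup M0 gM.
pose Q : set (borel_rV R d) := cube d%:R^-1.
have mQ : measurable Q by exact: measurable_cube.
have mrefl := lebesgue_measurable_refl x.
have mh := measurableT_comp msup mrefl.
have mr := measurableT_comp rho_meas mrefl.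
have int_refl : (\int[mu]_y (unit_sup rho \o point_refl x) y =
                 \int[mu]_y unit_sup rho y)%E.
  by apply: (ge0_integral_refl x msup) => y; exact: unit_sup_ge0.
rewrite -[X in (_ <= X * _)%E]int_refl.
have d_ge0 : 0 <= d%:R^-1 :> R by rewrite invr_ge0.
rewrite -[X in (X * _ <= _)%E](lebesgue_measure_cube d d_ge0).
apply: (@indic_schur_integral_le _ _ _ _ R
  (lebesgue_sf_measure_rV R d) (lebesgue_sf_measure_rV R d)
  [set z : leb * leb | Q ((z.1 : 'rV[R]_d) - z.2)] (unit_sup rho \o point_refl x)
  g (EFin \o rho \o point_refl x)
  (fun z => (g \_ (unit_cball z : set leb))) _ M).
- exact: measurable_sub_preimage.
- exact: mh.
- exact: mg.
- exact/measurable_EFinP.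
- move=> z; apply/(measurable_restrictT _ (measurable_unit_cball z)).
  exact: measurable_funTS.
- by move=> y; exact: unit_sup_ge0.
- exact: g0.
- by move=> y; rewrite lee_fin.
- by move=> z y; exact: erestrict_ge0.
- exact: measure_ge0.
- exact: M0.
- by move=> z y /cube_unit_cball zy; rewrite patchE mem_set.
- by move=> z; have := gM z; rewrite integral_mkcond.
- move=> z y /= Qzy; apply: le_unit_sup.
  apply: cube_unit_cball => i; have := Qzy i.
  rewrite /point_refl !mxE distrC; congr (`|_| <= _); ring.
- by move=> y; exact: lebesgue_integral_indic_sub.
Qed.

(** Averaging the weighted integrals over the centres [w] in the cube [D] of
    centre [x] and half side [n + 1]: if [y] lies within distance 1 of [x] and
    [w - y] in [B], then [w] lies in [D], so every such [y] sees the whole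
    measure of [B]. *)
Lemma local_integral_le (M : \bar R) (x : 'rV[R]_d) (n : nat) (e : R)
    (B : set (borel_rV R d)) :
  (0 <= M)%E -> 0 <= e -> measurable B -> B `<=` cube n%:R ->
  B `<=` [set x | e <= rho x] ->
  (forall w : 'rV[R]_d,
     \int[mu]_y ((rho (w - (y : 'rV[R]_d))%R)%:E * g y) <= M)%E ->
  (e%:E * mu B * \int[mu]_(y in unit_cball x) g y <=
   ((2 * n.+1%:R) ^+ d)%:E * M)%E.
Proof.
move=> M0 e0 mB BQ Brho gM.
have mB' : measurable (B : set leb) by exact: lebesgue_measurable_borel.
pose Q : set (borel_rV R d) := cube n.+1%:R.
have mQ : measurable (Q : set leb).
  by apply: lebesgue_measurable_borel; exact: measurable_cube.
pose D : set leb := point_refl x @^-1` Q.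
have mD : measurable D.
  by rewrite -[X in measurable X]setTI; exact: lebesgue_measurable_refl.
have mA := measurable_unit_cball x.
pose r (w y : leb) : \bar R := ((rho (point_refl w y))%:E * g y)%E.
have intA : (e%:E * mu B * \int[mu]_(y in unit_cball x) g y =
    mu B * \int[mu]_y ((\1_(unit_cball x : set leb) y)%:E * (e%:E * g y)))%E.
  by rewrite muleAC muleC -ge0_integral_scale_indic.
have intD : mu D = ((2 * n.+1%:R) ^+ d)%:E.
  rewrite -(@lebesgue_measure_cube R d)//; exact: lebesgue_outer_refl.
rewrite intA -intD.
have -> : mu D = (\int[mu]_w (\1_D w)%:E)%E.
  apply/esym; apply: etrans (integral_indic mu measurableT mD) _.
  by rewrite setIT.
apply: (@indic_schur_integral_le _ _ _ _ R
  (lebesgue_sf_measure_rV R d) (lebesgue_sf_measure_rV R d)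
  [set z : leb * leb | B ((z.1 : 'rV[R]_d) - z.2)] (EFin \o \1_D)
  (fun y => e%:E * g y)%E (EFin \o \1_(unit_cball x : set leb)) r _ M).
- exact: measurable_sub_preimage.
- exact/measurable_EFinP/measurable_indic.
- exact: emeasurable_funM.
- exact/measurable_EFinP/measurable_indic.
- move=> w; apply: emeasurable_funM; last exact: mg.
  apply/measurable_EFinP.
  exact: (measurableT_comp rho_meas (lebesgue_measurable_refl w)).
- by move=> w; rewrite lee_fin.
- by move=> y; rewrite mule_ge0.
- by move=> y; rewrite lee_fin.
- by move=> w y; rewrite mule_ge0// lee_fin.
- exact: measure_ge0.
- exact: M0.
- by move=> w y /= /Brho ewy; rewrite lee_wpmul2r// lee_fin.
- exact: gM.
- move=> w y /= Bwy; rewrite lee_fin !indicE.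
  have [|_] := boolP (y \in _); last by rewrite ler0n.
  rewrite inE => /unit_cball_cube xy; rewrite mem_set// => i.
  have wy := BQ _ Bwy i; have := xy i; move: wy; rewrite /point_refl !mxE => wy xy'.
  rewrite -natr1 distrC.
  rewrite (_ : _ - _ = (w 0 i - y 0 i) - (x 0 i - y 0 i)); last by ring.
  by rewrite (le_trans (ler_normB _ _))// lerD.
- by move=> y; exact: lebesgue_integral_indic_sub.
Qed.

End bounds.

(** * Comparison of the norms *)

Section norms.
Context (R : realType) (d : nat).
Local Notation leb := (lebesgue_rV R d).
Local Notation mu := (lebesgue_measure_rV R d).
Variables (p : R) (p0 : 0 < p).
Variables (rho : 'rV[R]_d -> R).
Hypotheses (rho_ge0 : forall x, 0 <= rho x).
Hypotheses (rho_meas : lebesgue_measurable rho).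

Lemma measurable_norm_powR (f : 'rV[R]_d -> R) : lebesgue_measurable f ->
  measurable_fun [set: leb] (fun y : leb => (`|f y| `^ p)%:E : \bar R).
Proof.
move=> mf; apply/measurable_EFinP.
have mn : measurable_fun [set: leb] (fun y : leb => `|f y| : R).
  exact: (measurableT_comp (@normr_measurable R setT) mf).
exact: (measurableT_comp (@measurable_powR R p) mn).
Qed.

Lemma Lul_norm_ge0 f : (0 <= @Lul_norm R d p f)%E.
Proof. exact: (ereal_sup_poweR_inv_ge0 _ (0 : 'rV[R]_d)). Qed.

Lemma weighted_norm_ge0 f : (0 <= @weighted_norm R d rho p f)%E.
Proof. exact: (ereal_sup_poweR_inv_ge0 _ (0 : 'rV[R]_d)). Qed.

Lemma weighted_norm_le :
  mu.-integrable setT (unit_sup rho) -> (1 <= d)%N ->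
  exists2 K : R, 0 <= K & forall f, lebesgue_measurable f ->
    (weighted_norm rho p f <= K%:E * Lul_norm p f)%E.
Proof.
move=> /integrableP[msup supoo] d1.
have int_ge0 : (0 <= \int[mu]_y unit_sup rho y)%E.
  by apply: integral_ge0 => y _; exact: unit_sup_ge0.
have int_fin : (\int[mu]_y unit_sup rho y)%E \is a fin_num.
  rewrite ge0_fin_numE// (le_lt_trans _ supoo)//.
  rewrite (eq_integral (fun y : leb => `|unit_sup rho y|)%E)// => y _.
  by rewrite gee0_abs// unit_sup_ge0.
set S := (\int[mu]_y unit_sup rho y)%E in int_ge0 int_fin.
pose v : R := (2 * d%:R^-1) ^+ d.
have v0 : 0 < v by rewrite exprn_gt0// mulr_gt0// invr_gt0 ltr0n.
pose K := v^-1 * fine S.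
have K0 : 0 <= K by apply: mulr_ge0; [rewrite invr_ge0 ltW|exact: fine_ge0].
exists (K `^ p^-1); first exact: powR_ge0.
move=> f mf; apply: ereal_sup_poweR_inv_le => //; first exact: Lul_norm_ge0.
  by move=> x; apply: integral_ge0 => y _; rewrite lee_fin mulr_ge0// powR_ge0.
move=> x; rewrite /K EFinM -muleA lee_pdivlMl// fineK//.
apply: (weighted_integral_le rho_ge0 rho_meas (measurable_norm_powR mf)) => //.
- exact: poweR_ge0.
- move=> z; apply: (le_ereal_sup_poweR_inv p0
    (I := fun x => \int[mu]_(y in unit_cball x) (`|f y| `^ p)%:E)%E).
  by move=> w; apply: integral_ge0 => y _; rewrite lee_fin powR_ge0.
Qed.

Lemma Lul_norm_le :
  mu [set x | 0 < rho x] != 0%E ->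
  exists2 K : R, 0 < K & forall f, lebesgue_measurable f ->
    (Lul_norm p f <= K%:E * weighted_norm rho p f)%E.
Proof.
move=> /(exists_borel_lower_bound rho_meas)[n [B [mB B0 BQ Brho]]].
have n0 : 0 <= n%:R :> R by [].
have mB' : measurable (B : set leb) by exact: lebesgue_measurable_borel.
have mQ' : measurable (cube n%:R : set leb).
  by apply: lebesgue_measurable_borel; exact: measurable_cube.
have Bfin : mu B \is a fin_num.
  rewrite ge0_fin_numE ?measure_ge0// (@le_lt_trans _ _ (mu (cube n%:R)))//.
    by rewrite le_measure// inE.
  by rewrite (lebesgue_measure_cube d n0) ltry.
have Bgt0 : 0 < fine (mu B).
  by rewrite fine_gt0// lt0e B0 measure_ge0/= -ge0_fin_numE.
pose e : R := n.+1%:R^-1.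
pose K := (e * fine (mu B))^-1 * (2 * n.+1%:R) ^+ d.
have eB0 : 0 < e * fine (mu B) by rewrite mulr_gt0// invr_gt0.
have K0 : 0 < K by rewrite mulr_gt0 ?invr_gt0// exprn_gt0// mulr_gt0.
exists (K `^ p^-1); first exact: powR_gt0.
move=> f mf; apply: ereal_sup_poweR_inv_le => //.
- exact: ltW.
- exact: weighted_norm_ge0.
- by move=> x; apply: integral_ge0 => y _; rewrite lee_fin powR_ge0.
move=> x; rewrite /K EFinM -muleA lee_pdivlMl// EFinM fineK//.
apply: (local_integral_le rho_ge0 rho_meas (measurable_norm_powR mf)) => //.
- exact: poweR_ge0.
- by rewrite invr_ge0.
- by move=> y /Brho /ltW.
- move=> z; apply: (le_ereal_sup_poweR_inv p0
    (I := fun x => \int[mu]_y (rho (x - y) * `|f y| `^ p)%:E)%E).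
  by move=> w; apply: integral_ge0 => y _; rewrite lee_fin mulr_ge0// powR_ge0.
Qed.

End norms.

Theorem proposition3p2 (R : realType) (d : nat) (d_ge1 : (1 <= d)%N)
    (rho : 'rV[R]_d -> R)
    (rho_ge0 : forall x, 0 <= rho x)
    (rho_meas : lebesgue_measurable rho)
    (rho_pos : lebesgue_measure_rV R d [set x | 0 < rho x] != 0%E)
    (rho_L1 : (lebesgue_measure_rV R d).-integrable setT (unit_sup rho))
    (p : R) (p_ge1 : 1 <= p) :
  exists c C : R, [/\ 0 < c, c <= C & forall f : 'rV[R]_d -> R, Lul p f ->
    (c%:E * Lul_norm p f <= weighted_norm rho p f)%E /\
    (weighted_norm rho p f <= C%:E * Lul_norm p f)%E].
Proof.
have p0 : 0 < p by exact: lt_le_trans p_ge1.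
have [K K0 HK] := Lul_norm_le p0 rho_ge0 rho_meas rho_pos.
have [C C0 HC] := weighted_norm_le p0 rho_ge0 rho_meas rho_L1 d_ge1.
exists K^-1, (Num.max K^-1 C); split.
- by rewrite invr_gt0.
- by rewrite le_max lexx.
move=> f [[[mf _] _] _]; split.
  by rewrite lee_pdivrMl//; exact: HK.
apply: le_trans (HC f mf) _; rewrite lee_wpmul2r ?Lul_norm_ge0//.
by rewrite lee_fin le_max lexx orbT.
Qed.
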